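(* Let $L$ be a finitary first-order language, $T$ a theory (set of sentences) in $L_{\infty\omega}$, $\lambda$ a cardinal such that $T\subset L_{\lambda\omega}$, and $T^G$ the geometric Morleyisation of $T$, in the language $L^G$. (i) Every model $M$ of $T$ has a canonical expansion $M^G$ which is a model of $T^G$, and the $L$-reduct of every model of $T^G$ is a model of $T$. (ii) The categories $\mathcal M_{\lambda\omega}(T)$ (of $\lambda$-elementary extensions of models of $T$) and $\mathcal M(T^G)$ (of homomorphisms of models of $T^G$) are isomorphic.
   Context: $L$ is many-sorted and contains two $0$-ary relation symbols $\top$ (true) and $\bot$ (false), interpreted in the obvious way. $L_{\lambda\omega}$ is the smallest class of formulas containing the atomic $L$-formulas and closed under negation, conjunctions and disjunctions of sets of formulas of cardinality $<\lambda$ (such sets are called $\lambda$-small), and finite quantifications (existential and universal); $L_{\infty\omega}$ is the union of the classes $L_{\lambda\omega}$ over all cardinals $\lambda$. A formula $\phi(x)$ is a pair consisting of a formula $\phi$ and a finite tuple $x$ of variables containing all its free variables. A geometric formula is one belonging to the smallest class containing the atomic formulas and closed under finite conjunctions, existential quantification over single variables and arbitrary disjunctions. A g-inductive formula is one of the form $\forall y\,(\psi(x,y)\Rightarrow\chi(x,y))$ with $\psi,\chi$ geometric; a g-inductive theory is a set of g-inductive sentences. A homomorphism $f:A\to B$ of structures is a sorted map such that for every atomic sentence $\phi(a)$ with parameters in $A$, $A\models\phi(a)$ implies $B\models\phi(fa)$. A sorted map $f:M\to N$ of $L$-structures is $\lambda$-elementary if for every $\phi(x)\in L_{\lambda\omega}$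 and every tuple $a$ from $M$ with the sorts of $x$, $M\models\phi(a)$ implies $N\models\phi(fa)$. The objects of $\mathcal M_{\lambda\omega}(T)$ are the models of $T$ and its morphisms are the $\lambda$-elementary embeddings; the objects of $\mathcal M(T^G)$ are the models of $T^G$ and its morphisms are the $L^G$-homomorphisms. Geometric Morleyisation. $L^G$ is the first-order language with the same sorts as $L$, obtained by adding to $L$, for every formula $\phi(x)$ of $L_{\lambda\omega}$, a new relation symbol $R_\phi(x)$ of the same arity. $T^G$ is the g-inductive theory in $L^G$ consisting of the following sentences: (1) if $\phi(x)$ is atomic in $L$, two g-inductive sentences expressing $\forall x\,(\phi(x)\Leftrightarrow R_\phi(x))$; (2) if $\Phi(x)$ is a $\lambda$-small set of formulas of $L_{\lambda\omega}$, two g-inductive sentences expressing $\forall x\,(R_{\bigvee\Phi}(x)\Leftrightarrow\bigvee\{R_\phi(x):\phi\in\Phi\})$; (3) if $\phi(x)$ is in $L_{\lambda\omega}$, the sentences $\forall x\,(R_\phi(x)\wedge R_{\neg\phi}(x)\Rightarrow\bot)$ and $\forall x\,(\top\Rightarrow R_\phi(x)\vee R_{\neg\phi}(x))$, expressing $\forall x\,(\neg R_\phi(x)\Leftrightarrow R_{\neg\phi}(x))$; (4) if $\Phi(x)$ is a $\lambda$-small set of formulas of $L_{\lambda\omega}$, the sentences $\forall x\,(R_{\bigwedge\Phi}(x)\wedge\bigvee\{R_{\neg\psi}(x):\psi\in\Phi\}\Rightarrow\bot)$ and $\forall x\,(\top\Rightarrow R_{\bigwedge\Phi}(x)\vee\bigvee\{R_{\neg\psi}(x):\psi\in\Phi\})$,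 expressing $\forall x\,(R_{\bigwedge\Phi}(x)\Leftrightarrow\neg\bigvee\{R_{\neg\psi}(x):\psi\in\Phi\})$; (5) if $\phi(x,y)$ is in $L_{\lambda\omega}$, two sentences expressing $\forall x\,(R_{\exists y\phi}(x)\Leftrightarrow\exists y\,R_\phi(x,y))$; (6) if $\phi$ is a sentence in $T$, the propositional constant $R_\phi$. The canonical expansion $M^G$ of an $L$-structure $M$ is the $L^G$-structure obtained by interpreting each $R_\phi(x)$ as $\phi(x)^M$, the set of tuples of $M$ satisfying $\phi(x)$. *)

(* Defs.v *)
From Stdlib Require Import List FinFun Classical ProofIrrelevance FunctionalExtensionality.
Import ListNotations.

Set Implicit Arguments.

(** * Many-sorted languages, terms and formulas in context *)

(* The universe of sets: cardinals are represented by types of this universe,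
   which is also the one of the index types of conjunctions and disjunctions. *)
Definition SmallType := Type.

Record signature := Signature {
  sort : Type;
  fn : Type;
  dom : fn -> list sort;
  cod : fn -> sort
}.

(* [rel] does not include the 0-ary symbols "true" and "false", nor equality:
   these have a fixed interpretation and are constructors of [atomic]. *)
Record language := Language {
  sig : signature;
  rel : Type;
  arity : rel -> list (sort sig)
}.

(* Variables are typed de Bruijn indices: a context [G : list S] is a finite
   tuple of variables, given by their sorts. *)
Inductive var (S : Type) : list S -> S -> Type :=
| vz : forall G s, var (s :: G) s
| vs : forall G s s', var G s -> var (s' :: G) s.

Arguments vz {S G s}.
Arguments vs {S G s s'} v.

Definition tuple (S : Type) (X : S -> Type) (G : list S) : Type :=
  forall s, var G s -> X s.

Definition tcons (S : Type) (X : S -> Type) (s : S) (G : list S)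
    (x : X s) (a : tuple X G) : tuple X (s :: G) :=
  fun s' v =>
    match v in var D s1
      return match D with
             | nil => unit
             | s0 :: G0 => X s0 -> tuple X G0 -> X s1
             end
    with
    | vz => fun x _ => x
    | vs v' => fun _ a => a _ v'
    end x a.

Definition tmap (S : Type) (X Y : S -> Type) (f : forall s, X s -> Y s)
    (G : list S) (a : tuple X G) : tuple Y G :=
  fun s v => f s (a s v).

Arguments tmap {S X Y} f {G} a s v.

Inductive term (Sg : signature) (G : list (sort Sg)) : sort Sg -> Type :=
| tvar : forall s, var G s -> term Sg G s
| tapp : forall f : fn Sg, tuple (term Sg G) (dom Sg f) -> term Sg G (cod Sg f).

Arguments tvar {Sg G s} v.
Arguments tapp {Sg G} f ts.

Inductive atomic (L : language) (G : list (sort (sig L))) : Type :=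
| atop : atomic L G
| abot : atomic L G
| aeq : forall s, term (sig L) G s -> term (sig L) G s -> atomic L G
| arel : forall r : rel L, tuple (term (sig L) G) (arity L r) -> atomic L G.

Arguments atop {L G}.
Arguments abot {L G}.
Arguments aeq {L G s} t u.
Arguments arel {L G} r ts.

(* [formula L G] is the type of the formulas phi(x) of L_{oo omega} with x of
   sorts [G]; a set of formulas is given by a family enumerating it.  Universal
   quantification is the derived [fall] below. *)
Inductive formula (L : language) : list (sort (sig L)) -> Type :=
| fatom : forall G, atomic L G -> formula L G
| fneg : forall G, formula L G -> formula L G
| fconj : forall G (I : SmallType), (I -> formula L G) -> formula L G
| fdisj : forall G (I : SmallType), (I -> formula L G) -> formula L G
| fex : forall G s, formula L (s :: G) -> formula L G.

Arguments fatom {L G} a.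
Arguments fneg {L G} p.
Arguments fconj {L G} I p.
Arguments fdisj {L G} I p.
Arguments fex {L G s} p.

Definition sentence (L : language) : Type := formula L [].
Definition theory (L : language) : Type := sentence L -> Prop.

Definition fall (L : language) (G : list (sort (sig L))) (s : sort (sig L))
    (p : formula L (s :: G)) : formula L G :=
  fneg (fex (fneg p)).

Definition ftop (L : language) (G : list (sort (sig L))) : formula L G :=
  fatom atop.
Definition fbot (L : language) (G : list (sort (sig L))) : formula L G :=
  fatom abot.
Definition fand (L : language) (G : list (sort (sig L)))
    (p q : formula L G) : formula L G :=
  fconj bool (fun b => if b then p else q).
Definition for_ (L : language) (G : list (sort (sig L)))
    (p q : formula L G) : formula L G :=
  fdisj bool (fun b => if b then p else q).
Definition fimp (L : language) (G : list (sort (sig L)))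
    (p q : formula L G) : formula L G :=
  for_ (fneg p) q.

Arguments ftop {L G}.
Arguments fbot {L G}.

Fixpoint closure (L : language) (G : list (sort (sig L))) :
    formula L G -> sentence L :=
  match G with
  | [] => fun p => p
  | s :: G' => fun p => closure (fall p)
  end.

(** * The classes of formulas *)

Definition cardinal_lt (I K : SmallType) : Prop :=
  (exists f : I -> K, Injective f) /\ ~ (exists g : K -> I, Injective g).

(* L_{lambda omega} *)
Inductive Llam (L : language) (lambda : SmallType) :
    forall G, formula L G -> Prop :=
| Llam_atom : forall G (a : atomic L G), Llam lambda (fatom a)
| Llam_neg : forall G (p : formula L G), Llam lambda p -> Llam lambda (fneg p)
| Llam_conj : forall G (I : SmallType) (p : I -> formula L G),
    cardinal_lt I lambda -> (forall i, Llam lambda (p i)) ->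
    Llam lambda (fconj I p)
| Llam_disj : forall G (I : SmallType) (p : I -> formula L G),
    cardinal_lt I lambda -> (forall i, Llam lambda (p i)) ->
    Llam lambda (fdisj I p)
| Llam_ex : forall G s (p : formula L (s :: G)),
    Llam lambda p -> Llam lambda (fex p).

Lemma Llam_all (L : language) (lambda : SmallType) G s (p : formula L (s :: G)) :
  Llam lambda p -> Llam lambda (fall p).
Proof.
intros Hp; apply Llam_neg, Llam_ex, Llam_neg, Hp.
Qed.

Inductive geometric (L : language) : forall G, formula L G -> Prop :=
| geo_atom : forall G (a : atomic L G), geometric (fatom a)
| geo_conj : forall G (I : SmallType) (p : I -> formula L G),
    Finite I -> (forall i, geometric (p i)) -> geometric (fconj I p)
| geo_disj : forall G (I : SmallType) (p : I -> formula L G),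
    (forall i, geometric (p i)) -> geometric (fdisj I p)
| geo_ex : forall G s (p : formula L (s :: G)),
    geometric p -> geometric (fex p).

Definition g_inductive (L : language) (p : sentence L) : Prop :=
  exists G (psi chi : formula L G),
    geometric psi /\ geometric chi /\ p = closure (fimp psi chi).

(** * Structures and satisfaction *)

Record structure (L : language) := Structure {
  carrier : sort (sig L) -> Type;
  fun_int : forall f : fn (sig L),
    tuple carrier (dom (sig L) f) -> carrier (cod (sig L) f);
  rel_int : forall r : rel L, tuple carrier (arity L r) -> Prop
}.

Arguments carrier {L} M s : rename.
Arguments fun_int {L} M f a : rename.
Arguments rel_int {L} M r a : rename.

Fixpoint eval (L : language) (M : structure L) G (a : tuple (carrier M) G)
    s (t : term (sig L) G s) : carrier M s :=
  match t with
  | tvar v => a _ v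
  | tapp f ts => fun_int M f (fun s' v => eval M a (ts s' v))
  end.

Definition sat_atomic (L : language) (M : structure L) G (p : atomic L G)
    (a : tuple (carrier M) G) : Prop :=
  match p with
  | atop => True
  | abot => False
  | aeq t u => eval M a t = eval M a u
  | arel r ts => rel_int M r (fun s v => eval M a (ts s v))
  end.

Fixpoint sat (L : language) (M : structure L) G (p : formula L G) :
    tuple (carrier M) G -> Prop :=
  match p in formula _ D return tuple (carrier M) D -> Prop with
  | fatom p => fun a => sat_atomic M p a
  | fneg p => fun a => ~ sat M p a
  | fconj J p => fun a => forall i, sat M (p i) a
  | fdisj J p => fun a => exists i, sat M (p i) a
  | @fex _ _ s p => fun a => exists x : carrier M s, sat M p (tcons x a)
  end.

Definition tnil (S : Type) (X : S -> Type) : tuple X [] :=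
  fun s v => match v in var D s1
               return match D with nil => X s1 | _ => unit end
             with vz => tt | vs _ => tt end.

Definition models (L : language) (M : structure L) (T : theory L) : Prop :=
  forall p, T p -> sat M p (tnil (carrier M)).

Lemma sat_all (L : language) (M : structure L) G s (p : formula L (s :: G)) a :
  sat M (fall p) a <-> forall x : carrier M s, sat M p (tcons x a).
Proof.
simpl; split.
- intros H x; apply NNPP; intros Hx; apply H; exists x; exact Hx.
- intros H [x Hx]; exact (Hx (H x)).
Qed.

Lemma sat_imp (L : language) (M : structure L) G (p q : formula L G) a :
  sat M (fimp p q) a <-> (sat M p a -> sat M q a).
Proof.
simpl; split.
- intros [[|] H]; simpl in H; tauto.
- intros H; destruct (classic (sat M p a)) as [Hp | Hp].
  + exists false; exact (H Hp).
  + exists true; exact Hp.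
Qed.

Lemma tuple_nil (S : Type) (X : S -> Type) (a : tuple X []) : a = tnil X.
Proof.
extensionality s; extensionality v.
refine (match v as v0 in var D s1
          return match D return var D s1 -> Prop with
                 | nil => fun w => forall b : tuple X [], b s1 w = tnil X w
                 | _ => fun _ => True
                 end v0
        with vz => I | vs _ => I end a).
Qed.

Lemma tuple_cons (S : Type) (X : S -> Type) s (G : list S)
    (a : tuple X (s :: G)) :
  tcons (a s vz) (fun s' v => a s' (vs v)) = a.
Proof.
extensionality s'; extensionality v.
refine (match v as v0 in var D s1
          return match D return var D s1 -> Prop with
                 | nil => fun _ => True
                 | s0 :: G0 => fun w => forall b : tuple X (s0 :: G0),
                     tcons (b s0 vz) (fun s2 u => b s2 (vs u)) w = b s1 w
                 end v0
        with vz => fun b => eq_refl | vs _ => fun b => eq_refl end a).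
Qed.

Lemma sat_closure (L : language) (M : structure L) G (p : formula L G) :
  sat M (closure p) (tnil (carrier M)) <-> forall a, sat M p a.
Proof.
induction G as [|s G IH].
- split; intros H; [intros a; rewrite (tuple_nil a); exact H | apply H].
- simpl closure; rewrite IH; split.
  + intros H a; rewrite <- (tuple_cons a).
    exact (proj1 (sat_all M p _) (H _) _).
  + intros H a; apply sat_all; intros x; apply H.
Qed.

(** * Geometric Morleyisation *)

Inductive relG (L : language) (lambda : SmallType) : Type :=
| relG_old : rel L -> relG L lambda
| relG_new : forall G (p : formula L G), Llam lambda p -> relG L lambda.

Arguments relG_old {L lambda} r.
Arguments relG_new {L lambda G} p Hp.

Definition arityG (L : language) (lambda : SmallType) (r : relG L lambda) :
    list (sort (sig L)) :=
  match r with
  | relG_old r => arity L r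
  | @relG_new _ _ G _ _ => G
  end.

Definition LG (L : language) (lambda : SmallType) : language :=
  @Language (sig L) (relG L lambda) (@arityG L lambda).

Definition liftG (L : language) (lambda : SmallType) G (p : atomic L G) :
    atomic (LG L lambda) G :=
  match p with
  | atop => atop
  | abot => abot
  | aeq t u => @aeq (LG L lambda) G _ t u
  | arel r ts => @arel (LG L lambda) G (relG_old r) ts
  end.

(* R_p(x), for p = p(x) *)
Definition Rf (L : language) (lambda : SmallType) G (p : formula L G)
    (Hp : Llam lambda p) : formula (LG L lambda) G :=
  fatom (@arel (LG L lambda) G (relG_new p Hp) (fun s v => tvar v)).

Definition gsent (L : language) G (psi chi : formula L G) : sentence L :=
  closure (fimp psi chi).

Inductive TG (L : language) (lambda : SmallType) (T : theory L) :
    theory (LG L lambda) :=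
| TG_atom1 : forall G (p : atomic L G),
    TG T (gsent (fatom (liftG lambda p)) (Rf (Llam_atom lambda p)))
| TG_atom2 : forall G (p : atomic L G),
    TG T (gsent (Rf (Llam_atom lambda p)) (fatom (liftG lambda p)))
| TG_disj1 : forall G (I : SmallType) (p : I -> formula L G)
    (HI : cardinal_lt I lambda) (Hp : forall i, Llam lambda (p i)),
    TG T (gsent (Rf (Llam_disj p HI Hp)) (fdisj I (fun i => Rf (Hp i))))
| TG_disj2 : forall G (I : SmallType) (p : I -> formula L G)
    (HI : cardinal_lt I lambda) (Hp : forall i, Llam lambda (p i)),
    TG T (gsent (fdisj I (fun i => Rf (Hp i))) (Rf (Llam_disj p HI Hp)))
| TG_neg1 : forall G (p : formula L G) (Hp : Llam lambda p),
    TG T (gsent (fand (Rf Hp) (Rf (Llam_neg Hp))) fbot)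
| TG_neg2 : forall G (p : formula L G) (Hp : Llam lambda p),
    TG T (gsent ftop (for_ (Rf Hp) (Rf (Llam_neg Hp))))
| TG_conj1 : forall G (I : SmallType) (p : I -> formula L G)
    (HI : cardinal_lt I lambda) (Hp : forall i, Llam lambda (p i)),
    TG T (gsent (fand (Rf (Llam_conj p HI Hp))
                      (fdisj I (fun i => Rf (Llam_neg (Hp i))))) fbot)
| TG_conj2 : forall G (I : SmallType) (p : I -> formula L G)
    (HI : cardinal_lt I lambda) (Hp : forall i, Llam lambda (p i)),
    TG T (gsent ftop (for_ (Rf (Llam_conj p HI Hp))
                           (fdisj I (fun i => Rf (Llam_neg (Hp i))))))
| TG_ex1 : forall G s (p : formula L (s :: G)) (Hp : Llam lambda p),
    TG T (gsent (Rf (Llam_ex Hp)) (fex (Rf Hp)))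
| TG_ex2 : forall G s (p : formula L (s :: G)) (Hp : Llam lambda p),
    TG T (gsent (fex (Rf Hp)) (Rf (Llam_ex Hp)))
| TG_theory : forall (p : sentence L) (Hp : Llam lambda p),
    T p -> TG T (gsent ftop (Rf Hp)).

Arguments TG {L} lambda T p.

Lemma Finite_bool : Finite bool.
Proof. exists [true; false]; intros [|]; simpl; auto. Qed.

Lemma TG_g_inductive (L : language) (lambda : SmallType) (T : theory L) p :
  TG lambda T p -> g_inductive p.
Proof.
destruct 1; do 3 eexists; (split; [|split; [|reflexivity]]);
  repeat first [ apply geo_atom
               | apply geo_conj; [apply Finite_bool|]
               | apply geo_disj
               | apply geo_ex
               | progress intros
               | match goal with |- context [if ?b then _ else _] =>
                   destruct b end ].
Qed.

Definition expansion (L : language) (lambda : SmallType) (M : structure L) :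
    structure (LG L lambda) :=
  @Structure (LG L lambda) (carrier M) (fun_int M)
    (fun r => match r return tuple (carrier M) (arityG r) -> Prop with
              | relG_old r => rel_int M r
              | relG_new p _ => sat M p
              end).

Definition reduct (L : language) (lambda : SmallType)
    (N : structure (LG L lambda)) : structure L :=
  @Structure L (carrier N) (fun_int N) (fun r => rel_int N (relG_old r)).

(** * Categories of models *)

Definition sorted_map (L : language) (M N : structure L) : Type :=
  forall s, carrier M s -> carrier N s.

Definition homomorphism (L : language) (M N : structure L)
    (f : sorted_map M N) : Prop :=
  forall G (p : atomic L G) (a : tuple (carrier M) G),
    sat_atomic M p a -> sat_atomic N p (tmap f a).

Definition elementary (L : language) (lambda : SmallType) (M N : structure L)
    (f : sorted_map M N) : Prop :=
  forall G (p : formula L G), Llam lambda p ->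
  forall a : tuple (carrier M) G, sat M p a -> sat N p (tmap f a).

Record category := Category {
  ob : Type;
  hom : ob -> ob -> Type;
  idc : forall X, hom X X;
  comp : forall X Y Z, hom Y Z -> hom X Y -> hom X Z;
  comp_idl : forall X Y (f : hom X Y), comp (idc Y) f = f;
  comp_idr : forall X Y (f : hom X Y), comp f (idc X) = f;
  comp_assoc : forall X Y Z W (h : hom Z W) (g : hom Y Z) (f : hom X Y),
    comp h (comp g f) = comp (comp h g) f
}.

Arguments hom {c} X Y.
Arguments idc {c} X.
Arguments comp {c X Y Z} g f.

Record functor (C D : category) := Functor {
  fob : ob C -> ob D;
  fmap : forall X Y, hom X Y -> hom (fob X) (fob Y);
  fmap_id : forall X, fmap X X (idc X) = idc (fob X);
  fmap_comp : forall X Y Z (g : hom Y Z) (f : hom X Y),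
    fmap X Z (comp g f) = comp (fmap Y Z g) (fmap X Y f)
}.

Arguments fob {C D} F X : rename.
Arguments fmap {C D} F {X Y} f : rename.

Definition functor_id (C : category) : functor C C :=
  @Functor C C (fun X => X) (fun _ _ f => f)
    (fun _ => eq_refl) (fun _ _ _ _ _ => eq_refl).

Definition functor_comp (C D E : category) (K : functor D E) (F : functor C D) :
    functor C E.
Proof.
refine (@Functor C E (fun X => fob K (fob F X))
          (fun _ _ f => fmap K (fmap F f)) _ _).
- intros X; rewrite !fmap_id; reflexivity.
- intros X Y Z g f; rewrite !fmap_comp; reflexivity.
Defined.

Definition isomorphic_categories (C D : category) : Prop :=
  exists (F : functor C D) (K : functor D C),
    functor_comp K F = functor_id C /\ functor_comp F K = functor_id D.

(* The category whose objects are the models of [T] and whose morphisms are the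
   sorted maps satisfying [P], for a class [P] closed under composition. *)
Definition concrete (L : language) (T : theory L)
    (P : forall M N : structure L, sorted_map M N -> Prop)
    (Pid : forall M, P M M (fun s x => x))
    (Pcomp : forall M N K (g : sorted_map N K) (f : sorted_map M N),
       P N K g -> P M N f -> P M K (fun s x => g s (f s x))) : category.
Proof.
refine (@Category {M : structure L | models M T}
  (fun M N => {f : sorted_map (proj1_sig M) (proj1_sig N) | P _ _ f})
  (fun M => exist _ _ (Pid (proj1_sig M)))
  (fun M N K g f =>
     exist _ _ (Pcomp _ _ _ _ _ (proj2_sig g) (proj2_sig f))) _ _ _).
- intros M N [f Hf]; apply subset_eq_compat; reflexivity.
- intros M N [f Hf]; apply subset_eq_compat; reflexivity.
- intros M N K Q h g f; apply subset_eq_compat; reflexivity.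
Defined.

(* M_{lambda omega}(T) *)
Definition M_lambda (L : language) (lambda : SmallType) (T : theory L) :
    category :=
  @concrete L T (@elementary L lambda) (fun M G p Hp a H => H)
    (fun M N K g f Hg Hf G p Hp a H => Hg G p Hp _ (Hf G p Hp a H)).

(* M(T) *)
Definition M_hom (L : language) (T : theory L) : category :=
  @concrete L T (@homomorphism L) (fun M G p a H => H)
    (fun M N K g f Hg Hf G p a H => Hg G p _ (Hf G p a H)).

(* Main.v *)
From Stdlib Require Import Classical ProofIrrelevance.
From Stdlib Require Import FunctionalExtensionality PropExtensionality.
Require Import Defs.

Set Implicit Arguments.

(** The axioms of the geometric Morleyisation are the clauses of Tarski's
    definition of truth, with negation expressed by saying that two geometric
    formulas exclude each other and jointly exhaust all cases.  Hence a structure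
    [N] is a model of [TG lambda T] exactly when it is truthful, meaning that it
    interprets every new symbol [R_p] as the set of tuples satisfying [p] in its
    reduct, and that reduct is a model of [T] ([models_TG]): one direction is an
    induction on formulas of L_{lambda omega}, in the other each axiom becomes a
    tautology of classical logic or a sentence of [T].  Canonical expansions are truthful by
    construction, so the claims about models follow; moreover a truthful
    structure is determined by its reduct ([rel_int_truthful]), so expansion and
    reduct are mutually inverse on objects.

    On morphisms both functors keep the underlying sorted map.  A homomorphism
    for the enlarged language preserves every [R_p], that is, the truth of every
    formula of L_{lambda omega} ([homomorphism_elementary]).  Conversely, an
    elementary map preserves the [R_p] at tuples of elements; since equations
    [f(x) = y] are among the formulas it preserves, it commutes with the
    evaluation of terms, and so it preserves the [R_p] at tuples of terms too
    ([elementary_homomorphism]).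

    The composites of the two functors fix each object only up to a propositional
    equality of structures, so comparing them with the identity functors seems to
    need a transport of morphisms.  [functor_id_criterion] replaces it by a
    natural family of identity maps. *)

(** * Truth of the Morleyisation *)

Lemma sat_gsent (L : language) (M : structure L) G (p q : formula L G) :
  sat M (gsent p q) (tnil (carrier M)) <->
  forall a, sat M p a -> sat M q a.
Proof.
unfold gsent; rewrite sat_closure.
split; intros H a; apply sat_imp, H.
Qed.

Lemma sat_and (L : language) (M : structure L) G (p q : formula L G) a :
  sat M (fand p q) a <-> sat M p a /\ sat M q a.
Proof.
split.
- intros H; exact (conj (H true) (H false)).
- intros [Hp Hq] [|]; assumption.
Qed.

Lemma sat_or (L : language) (M : structure L) G (p q : formula L G) a :
  sat M (for_ p q) a <-> sat M p a \/ sat M q a.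
Proof.
split.
- intros [[|] H]; [left | right]; exact H.
- intros [H | H]; [exists true | exists false]; exact H.
Qed.

(** The language is an argument of the recursion defining [eval], so the two sides
    agree only by induction although they perform the same computation. *)
Lemma eval_reduct (L : language) (lambda : SmallType)
    (N : structure (LG L lambda)) G (a : tuple (carrier N) G) s
    (t : term (sig L) G s) :
  @eval (LG L lambda) N G a s t = eval (reduct N) a t.
Proof.
induction t as [s v | f ts IH]; simpl; [reflexivity |].
f_equal; extensionality s; extensionality v; apply IH.
Qed.

Lemma sat_liftG (L : language) (lambda : SmallType)
    (N : structure (LG L lambda)) G (p : atomic L G) (a : tuple (carrier N) G) :
  sat_atomic N (liftG lambda p) a <-> sat_atomic (reduct N) p a.
Proof.
destruct p as [| | s t u | r ts]; simpl; try reflexivity.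
- rewrite !eval_reduct; reflexivity.
- replace (fun s v => eval (reduct N) a (ts s v))
    with (fun s v => @eval (LG L lambda) N G a s (ts s v)); [reflexivity |].
  extensionality s; extensionality v; apply eval_reduct.
Qed.

Lemma reduct_expansion (L : language) (lambda : SmallType) (M : structure L) :
  reduct (expansion lambda M) = M.
Proof. destruct M; reflexivity. Qed.

(** This characterises the canonical expansion among all structures with a given
    reduct; see [rel_int_truthful]. *)
Definition truthful (L : language) (lambda : SmallType)
    (N : structure (LG L lambda)) : Prop :=
  forall G (p : formula L G) (Hp : Llam lambda p) (a : tuple (carrier N) G),
    sat N (Rf Hp) a <-> sat (reduct N) p a.

Lemma truthful_expansion (L : language) (lambda : SmallType) (M : structure L) :
  truthful (expansion lambda M).
Proof.
intros G p Hp a; destruct M; reflexivity.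
Qed.

(** Each step of the induction is the axiom for the outermost connective of [p].
    The symbol [R_p] carries a proof that [p] lies in L_{lambda omega}, and the
    axioms mention only proofs built from those of the subformulas of [p]; proof
    irrelevance identifies an arbitrary proof with one of these. *)
Lemma models_TG_truthful (L : language) (lambda : SmallType) (T : theory L)
    (N : structure (LG L lambda)) :
  models N (TG lambda T) -> truthful N.
Proof.
intros HN.
assert (ax : forall G (q r : formula (LG L lambda) G),
          TG lambda T (gsent q r) -> forall a, sat N q a -> sat N r a)
  by (intros G q r H; apply sat_gsent, HN, H).
assert (ax_neg : forall G (p : formula L G) (Hp : Llam lambda p) a,
          sat N (Rf (Llam_neg Hp)) a <-> ~ sat N (Rf Hp) a).
{ intros G p Hp a; split.
  - intros Hn H; apply (ax _ _ _ (TG_neg1 T Hp) a), sat_and; split; assumption.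
  - intros Hn.
    destruct (proj1 (sat_or N _ _ a) (ax _ _ _ (TG_neg2 T Hp) a Logic.I));
      tauto. }
intros G p Hp; generalize Hp.
induction Hp as [G p | G p Hp IH | G I p HI Hp IH | G I p HI Hp IH | G s p Hp IH];
  intros Hp' a.
- rewrite (proof_irrelevance _ Hp' (Llam_atom lambda p)).
  etransitivity; [| exact (sat_liftG N p a)].
  split;
    [exact (ax _ _ _ (TG_atom2 lambda T p) a) | exact (ax _ _ _ (TG_atom1 lambda T p) a)].
- rewrite (proof_irrelevance _ Hp' (Llam_neg Hp)), ax_neg, IH; reflexivity.
- rewrite (proof_irrelevance _ Hp' (Llam_conj p HI Hp)); split.
  + intros H i; rewrite <- (IH i (Hp i)); apply NNPP; intros Hi.
    apply (ax _ _ _ (TG_conj1 T p HI Hp) a), sat_and.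
    split; [exact H | exists i; apply ax_neg, Hi].
  + intros H.
    destruct (proj1 (sat_or N _ _ a) (ax _ _ _ (TG_conj2 T p HI Hp) a Logic.I))
      as [Hc | [i Hi]]; [exact Hc |].
    exfalso; apply ax_neg in Hi; apply Hi, IH, H.
- rewrite (proof_irrelevance _ Hp' (Llam_disj p HI Hp)); split.
  + intros H; destruct (ax _ _ _ (TG_disj1 T p HI Hp) a H) as [i Hi].
    exists i; apply (IH i (Hp i)), Hi.
  + intros [i Hi]; apply (ax _ _ _ (TG_disj2 T p HI Hp) a).
    exists i; apply IH, Hi.
- rewrite (proof_irrelevance _ Hp' (Llam_ex Hp)); split.
  + intros H; destruct (ax _ _ _ (TG_ex1 T Hp) a H) as [x Hx].
    exists x; apply (IH Hp), Hx.
  + intros [x Hx]; apply (ax _ _ _ (TG_ex2 T Hp) a).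
    exists x; apply IH, Hx.
Qed.

(** Conversely to [models_TG_truthful], in a truthful [N] every axiom is a
    statement about satisfaction in the reduct: a classical tautology, or the
    truth of a sentence of [T]. *)
Lemma models_TG (L : language) (lambda : SmallType) (T : theory L)
    (hT : forall p, T p -> Llam lambda p) (N : structure (LG L lambda)) :
  models N (TG lambda T) <-> truthful N /\ models (reduct N) T.
Proof.
split.
- intros HN; pose proof (models_TG_truthful HN) as Ht; split; [exact Ht |].
  intros p Hp; apply (Ht _ p (hT p Hp)).
  exact (proj1 (sat_gsent N _ _) (HN _ (TG_theory T (hT p Hp) Hp)) _ Logic.I).
- intros [HN HT] q Hq; destruct Hq as [| | | | | | | | | | p Hp Tp];
    apply sat_gsent; intros a H.
  + apply HN, sat_liftG, H.
  + apply sat_liftG; apply HN in H; exact H.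
  + apply HN in H; destruct H as [i Hi]; exists i; apply HN, Hi.
  + destruct H as [i Hi]; apply HN; exists i; apply (HN _ _ (Hp i)), Hi.
  + apply sat_and in H; destruct H as [H Hn].
    apply HN in H, Hn; exact (Hn H).
  + apply sat_or; rewrite !(HN G); apply classic.
  + apply sat_and in H; destruct H as [H [i Hi]].
    apply HN in H, Hi; exact (Hi (H i)).
  + apply sat_or; rewrite (HN G).
    apply NNPP; intros Hn; apply Hn; left; intros i.
    apply NNPP; intros Hi; apply Hn; right; exists i; apply HN, Hi.
  + apply HN in H; destruct H as [x Hx]; exists x; apply HN, Hx.
  + destruct H as [x Hx]; apply HN; exists x; apply (HN _ _ Hp), Hx.
  + apply HN; rewrite (tuple_nil a); apply HT, Tp.
Qed.

Lemma models_expansion (L : language) (lambda : SmallType) (T : theory L)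
    (hT : forall p, T p -> Llam lambda p) (M : structure L) :
  models M T -> models (expansion lambda M) (TG lambda T).
Proof.
intros HM; apply (models_TG T hT); split; [apply truthful_expansion |].
rewrite reduct_expansion; exact HM.
Qed.

Lemma models_reduct (L : language) (lambda : SmallType) (T : theory L)
    (hT : forall p, T p -> Llam lambda p)
    (N : structure (LG L lambda)) :
  models N (TG lambda T) -> models (reduct N) T.
Proof. intros HN; apply (models_TG T hT), HN. Qed.

(** Truthfulness leaves no freedom in the interpretation of the new symbols, so
    extensionality recovers a truthful structure from its reduct. *)
Lemma rel_int_truthful (L : language) (lambda : SmallType)
    (N : structure (LG L lambda)) :
  truthful N -> rel_int (expansion lambda (reduct N)) = rel_int N.
Proof.
intros HN; extensionality r; extensionality a.
destruct r as [r | G p Hp]; [reflexivity |].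
apply propositional_extensionality; symmetry; exact (HN G p Hp a).
Qed.

(** * Homomorphisms and elementary maps *)

(** The equation [f(x) = y] is an atomic formula true at [x] and the value of
    [f] at [x]; a homomorphism must preserve it. *)
Lemma homomorphism_fun (L : language) (M N : structure L) (h : sorted_map M N) :
  homomorphism h ->
  forall f (a : tuple (carrier M) (dom (sig L) f)),
    fun_int N f (tmap h a) = h _ (fun_int M f a).
Proof.
intros Hh f a.
exact (Hh (cod (sig L) f :: dom (sig L) f)%list
         (aeq (tapp f (fun s v => tvar (vs v))) (tvar vz))
         (tcons (fun_int M f a) a) eq_refl).
Qed.

Lemma homomorphism_eval (L : language) (M N : structure L) (h : sorted_map M N) :
  homomorphism h ->
  forall G (a : tuple (carrier M) G) s (t : term (sig L) G s),
    eval N (tmap h a) t = h _ (eval M a t).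
Proof.
intros Hh G a s t; induction t as [s v | f ts IH]; simpl; [reflexivity |].
rewrite <- (homomorphism_fun Hh); f_equal.
extensionality s; extensionality v; apply IH.
Qed.

Lemma homomorphism_elementary (L : language) (lambda : SmallType)
    (M N : structure (LG L lambda)) (h : sorted_map M N) :
  truthful M -> truthful N -> homomorphism h ->
  elementary lambda (M := reduct M) (N := reduct N) h.
Proof.
intros HM HN Hh G p Hp a H.
apply (HN G p Hp); apply (HM G p Hp) in H.
exact (Hh G _ a H).
Qed.

(** A new symbol may be applied to terms; as [h] commutes with their evaluation,
    the claim reduces to the elements they denote, where [h] is elementary. *)
Lemma elementary_homomorphism (L : language) (lambda : SmallType)
    (M N : structure (LG L lambda)) (h : sorted_map M N) :
  truthful M -> truthful N -> elementary lambda (M := reduct M) (N := reduct N) h ->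
  homomorphism h.
Proof.
intros HM HN Hh.
assert (Hr : homomorphism (M := reduct M) (N := reduct N) h)
  by (intros G p a; exact (Hh G (fatom p) (Llam_atom lambda p) a)).
intros G [| | s t u | [r | D p Hp] ts] a H.
- exact Logic.I.
- exact H.
- apply (sat_liftG N (@aeq L G s t u)), Hr, (sat_liftG M (@aeq L G s t u)), H.
- apply (sat_liftG N (@arel L G r ts)), Hr, (sat_liftG M (@arel L G r ts)), H.
- apply (HM D p Hp), (Hh D p Hp), (HN D p Hp) in H.
  refine (eq_ind _ (rel_int N (relG_new p Hp)) H _ _).
  extensionality s; extensionality v.
  simpl; unfold tmap at 1; rewrite !eval_reduct; symmetry.
  exact (homomorphism_eval Hr a (ts s v)).
Qed.

(** * Isomorphisms of categories *)

(** The hypothesis says that [i] is a natural transformation from [F] to the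
    identity whose components are identities, up to an equality of objects.
    Pairing each object with its component turns the hypothesis into an
    equality of functions, and eliminating it makes [F] the identity on objects
    and morphisms at once, with no transport. *)
Lemma functor_id_criterion (C : category) (F : functor C C)
    (i : forall X, hom (fob F X) X) :
  (forall X, existT (fun Y => hom Y X) (fob F X) (i X) =
             existT (fun Y => hom Y X) X (idc X)) ->
  (forall X Y (f : hom X Y), comp (i Y) (fmap F f) = comp f (i X)) ->
  F = functor_id C.
Proof.
destruct F as [fo fm fid fcomp]; simpl in *; intros Hi.
revert fm fid fcomp.
set (k := fun X => existT (fun Y => hom Y X) (fo X) (i X)).
assert (Hk : (fun X => existT (fun Y => hom Y X) X (idc X)) = k)
  by (extensionality X; symmetry; apply Hi).
change i with (fun X => projT2 (k X)).
change fo with (fun X => projT1 (k X)).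
clearbody k; subst k; simpl; intros fm fid fcomp Hnat.
assert (E : (fun X Y f => f) = fm).
{ extensionality X; extensionality Y; extensionality f.
  rewrite <- (comp_idl C X Y (fm X Y f)), Hnat, comp_idr; reflexivity. }
subst fm; unfold functor_id; f_equal; apply proof_irrelevance.
Qed.

Definition with_rel (L : language) (M : structure L)
    (ri : forall r, tuple (carrier M) (arity L r) -> Prop) : structure L :=
  @Structure L (carrier M) (fun_int M) ri.

(** Reduct of expansion and expansion of reduct both have the form [with_rel];
    this supplies for them the equations between objects that
    [functor_id_criterion] requires. *)
Lemma concrete_with_rel (L : language) (T : theory L) P Pid Pcomp
    (X : ob (@concrete L T P Pid Pcomp))
    (ri : forall r, tuple (carrier (proj1_sig X)) (arity L r) -> Prop)
    (HM : models (with_rel (proj1_sig X) ri) T)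
    (Hi : P (with_rel (proj1_sig X) ri) (proj1_sig X) (fun s x => x)) :
  ri = rel_int (proj1_sig X) ->
  existT (fun Y : ob (@concrete L T P Pid Pcomp) => hom Y X)
    (exist (fun M => models M T) _ HM)
    (exist (P (with_rel (proj1_sig X) ri) (proj1_sig X)) (fun s x => x) Hi) =
  existT (fun Y : ob (@concrete L T P Pid Pcomp) => hom Y X) X (idc X).
Proof.
destruct X as [[c f r] HX]; simpl in *; intros ->.
unfold with_rel in *; simpl in *.
rewrite (proof_irrelevance _ HM HX).
unfold idc; simpl; f_equal; apply subset_eq_compat; reflexivity.
Qed.

(** * Expansion and reduct as functors *)

(** Rewriting with [reduct_expansion] would transport [h] between types; once the
    structures are destructed, the two statements are convertible instead. *)
Lemma elementary_reduct_expansion (L : language) (lambda : SmallType)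
    (M N : structure L) (h : sorted_map M N) :
  elementary lambda h ->
  elementary lambda (M := reduct (expansion lambda M))
    (N := reduct (expansion lambda N)) h.
Proof. destruct M, N; intros Hh; exact Hh. Qed.

Lemma elementary_from_reduct_expansion (L : language) (lambda : SmallType)
    (M : structure L) :
  elementary lambda (M := reduct (expansion lambda M)) (N := M) (fun s x => x).
Proof. destruct M; intros G p Hp a H; exact H. Qed.

Lemma homomorphism_from_expansion_reduct (L : language) (lambda : SmallType)
    (N : structure (LG L lambda)) :
  truthful N ->
  homomorphism (M := expansion lambda (reduct N)) (N := N) (fun s x => x).
Proof.
intros HN; apply elementary_homomorphism;
  [apply truthful_expansion | exact HN |].
apply (elementary_from_reduct_expansion (lambda := lambda) (reduct N)).
Qed.

Definition expansion_functor (L : language) (lambda : SmallType) (T : theory L)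
    (hT : forall p, T p -> Llam lambda p) :
  functor (M_lambda lambda T) (M_hom (TG lambda T)).
Proof.
unshelve refine (@Functor (M_lambda lambda T) (M_hom (TG lambda T))
  (fun M => exist (fun N => models N (TG lambda T))
     (expansion lambda (proj1_sig M)) (models_expansion hT (proj2_sig M)))
  (fun M N h => exist (@homomorphism (LG L lambda)
     (expansion lambda (proj1_sig M)) (expansion lambda (proj1_sig N)))
     (proj1_sig h) _) _ _).
- apply elementary_homomorphism; try apply truthful_expansion.
  apply (elementary_reduct_expansion (proj2_sig h)).
- intros M; apply subset_eq_compat; reflexivity.
- intros M N K g f; apply subset_eq_compat; reflexivity.
Defined.

Definition reduct_functor (L : language) (lambda : SmallType) (T : theory L)
    (hT : forall p, T p -> Llam lambda p) :
  functor (M_hom (TG lambda T)) (M_lambda lambda T).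
Proof.
unshelve refine (@Functor (M_hom (TG lambda T)) (M_lambda lambda T)
  (fun N => exist (fun M => models M T)
     (reduct (proj1_sig N)) (models_reduct hT (proj2_sig N)))
  (fun M N h => exist (@elementary L lambda
     (reduct (proj1_sig M)) (reduct (proj1_sig N))) (proj1_sig h) _) _ _).
- apply homomorphism_elementary;
    [exact (models_TG_truthful (proj2_sig M)) |
     exact (models_TG_truthful (proj2_sig N)) | exact (proj2_sig h)].
- intros M; apply subset_eq_compat; reflexivity.
- intros M N K g f; apply subset_eq_compat; reflexivity.
Defined.

Lemma reduct_expansion_functor (L : language) (lambda : SmallType) (T : theory L)
    (hT : forall p, T p -> Llam lambda p) :
  functor_comp (reduct_functor T hT) (expansion_functor T hT) =
  functor_id (M_lambda lambda T).
Proof.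
apply functor_id_criterion with (i := fun X : ob (M_lambda lambda T) =>
  exist (@elementary L lambda (reduct (expansion lambda (proj1_sig X)))
           (proj1_sig X))
    (fun s x => x) (elementary_from_reduct_expansion (proj1_sig X))).
- intros X; apply (concrete_with_rel X); reflexivity.
- intros X Y f; apply subset_eq_compat; reflexivity.
Qed.

Lemma expansion_reduct_functor (L : language) (lambda : SmallType) (T : theory L)
    (hT : forall p, T p -> Llam lambda p) :
  functor_comp (expansion_functor T hT) (reduct_functor T hT) =
  functor_id (M_hom (TG lambda T)).
Proof.
apply functor_id_criterion with (i := fun X : ob (M_hom (TG lambda T)) =>
  exist (@homomorphism (LG L lambda) (expansion lambda (reduct (proj1_sig X)))
           (proj1_sig X))
    (fun s x => x)
    (homomorphism_from_expansion_reduct (models_TG_truthful (proj2_sig X)))).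
- intros X; apply (concrete_with_rel X).
  apply rel_int_truthful, (models_TG_truthful (proj2_sig X)).
- intros X Y f; apply subset_eq_compat; reflexivity.
Qed.

Theorem proposition4p3
    (L : language) (lambda : SmallType) (T : theory L)
    (hT : forall p : sentence L, T p -> Llam lambda p) :
  ((forall M : structure L, models M T ->
      reduct (expansion lambda M) = M /\
      models (expansion lambda M) (TG lambda T)) /\
   (forall N : structure (LG L lambda), models N (TG lambda T) ->
      models (reduct N) T)) /\
  isomorphic_categories (M_lambda lambda T) (M_hom (TG lambda T)).
Proof.
split; [split |].
- intros M HM; split; [apply reduct_expansion | exact (models_expansion hT HM)].
- exact (models_reduct hT).
- exists (expansion_functor T hT), (reduct_functor T hT).
  split; [apply reduct_expansion_functor | apply expansion_reduct_functor].
Qed.
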